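(* Let $(H,[-,-,-])$ be an Abelian heap and let $e\in H$. Then $(H,[-,-,-])$ together with the binary operation defined, for all $x,y\in H$, by $$x\cdot_e y=[x,e,y]=x+_e y$$ is a commutative braceable (i.e. unital) truss; in fact $(H,+_e,\cdot_e)$ is a two-sided brace.
   Context: A heap is a non-empty set $H$ with a ternary operation $[-,-,-]$ satisfying $[v,w,[x,y,z]]=[[v,w,x],y,z]$ and $[x,x,y]=y=[y,x,x]$; it is Abelian if $[x,y,z]=[z,y,x]$. For an Abelian heap $H$ and $e\in H$, the operation $x+_e y=[x,e,y]$ makes $H$ into an Abelian group with neutral element $e$. A truss is an Abelian heap $T$ with an associative binary operation (juxtaposition) satisfying $w[x,y,z]=[wx,wy,wz]$ and $[x,y,z]w=[xw,yw,zw]$. It is commutative if the binary operation is commutative, and unital (braceable) if the binary operation has an identity. A two-sided brace is a set $A$ with a commutative group operation $+$ and a group operation $\cdot$ such that $a\cdot(b+c)=a\cdot b-a+a\cdot c$ and $(b+c)\cdot a=b\cdot a-a+c\cdot a$ for all $a,b,c\in A$. *)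

(* Defs.v *)
From mathcomp Require Import all_boot.

Set Implicit Arguments.
Unset Strict Implicit.
Unset Printing Implicit Defensive.

Record is_heap (H : Type) (br : H -> H -> H -> H) : Prop := IsHeap {
  heap_inhabited : inhabited H;
  heap_assoc : forall v w x y z, br v w (br x y z) = br (br v w x) y z;
  heap_malcev_l : forall x y, br x x y = y;
  heap_malcev_r : forall x y, br y x x = y
}.

Record is_abelian_heap (H : Type) (br : H -> H -> H -> H) : Prop :=
  IsAbelianHeap {
  abelian_heap_heap : is_heap br;
  heap_comm : forall x y z, br x y z = br z y x
}.

Record is_truss (T : Type) (br : T -> T -> T -> T) (mul : T -> T -> T) : Prop :=
  IsTruss {
  truss_abelian_heap : is_abelian_heap br;
  truss_mulA : associative mul;
  truss_mulDr : forall w x y z,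
    mul w (br x y z) = br (mul w x) (mul w y) (mul w z);
  truss_mulDl : forall w x y z,
    mul (br x y z) w = br (mul x w) (mul y w) (mul z w)
}.

Definition has_identity (T : Type) (mul : T -> T -> T) : Prop :=
  exists one, left_id one mul /\ right_id one mul.

Record is_commutative_braceable_truss (T : Type) (br : T -> T -> T -> T)
    (mul : T -> T -> T) : Prop := IsCommutativeBraceableTruss {
  cbtruss_truss : is_truss br mul;
  cbtruss_mulC : commutative mul;
  cbtruss_unital : has_identity mul
}.

Record is_group (A : Type) (op : A -> A -> A) (id : A) (inv : A -> A) : Prop :=
  IsGroup {
  group_assoc : associative op;
  group_left_id : left_id id op;
  group_right_id : right_id id op;
  group_left_inv : left_inverse id inv op;
  group_right_inv : right_inverse id inv op
}.

(* The neutral elements and the inversion maps are determined by the two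
   operations, so quantifying over them existentially loses nothing. *)
Definition is_two_sided_brace (A : Type) (add mul : A -> A -> A) : Prop :=
  exists (zero : A) (opp : A -> A) (one : A) (inv : A -> A),
    [/\ is_group add zero opp /\ commutative add,
        is_group mul one inv,
        forall a b c,
          mul a (add b c) = add (add (mul a b) (opp a)) (mul a c)
      & forall a b c,
          mul (add b c) a = add (add (mul b a) (opp a)) (mul c a)].

Definition heap_add (H : Type) (br : H -> H -> H -> H) (e x y : H) : H :=
  br x e y.

Definition heap_mul (H : Type) (br : H -> H -> H -> H) (e x y : H) : H :=
  br x e y.

(* Main.v *)
(* In the group (H, +_e) the bracket is [x, y, z] = x - y + z, so in
   [w + x, w + y, w + z] the translations by w telescope to w + [x, y, z], which
   is truss distributivity.  The brace axioms hold because both brace operations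
   are +_e, so a + b - a = b. *)

Require Import Defs.
From mathcomp Require Import all_boot.

(** Reading [br u v w] as $u v^{-1} w$, the inverse of $x e^{-1} y$ is $y^{-1} e x^{-1}$, whose last
    factor cancels against [x]. *)
Lemma heap_mid_cancel (H : Type) (br : H -> H -> H -> H) (heap_br : is_heap br)
    (a e x y : H) :
  br a (br x e y) x = br a y e.
Proof.
case: heap_br => _ brA brl brr.
have yE : br e x (br x e y) = y by rewrite brA brr brl.
(* The [e] on the right becomes a bracket starting with [y], so that reassociating cancels [y]. *)
have {2}<- : br y (br x e y) x = e by rewrite -{1}yE -brA brl brr.
by rewrite brA brr.
Qed.

Lemma heap_add_group (H : Type) (br : H -> H -> H -> H) (heap_br : is_heap br)
    (e : H) :
  is_group (heap_add br e) e (fun x => br e x e).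
Proof.
case: heap_br => _ brA brl brr.
split=> [x y z | x | x | x | x]; rewrite /heap_add //.
- by rewrite -brA brl brr.
- by rewrite brA brr brl.
Qed.

Lemma heap_addC (H : Type) (br : H -> H -> H -> H)
    (abelian_heap_br : is_abelian_heap br) (e : H) :
  commutative (heap_add br e).
Proof. by move=> x y; apply: (heap_comm abelian_heap_br). Qed.

Lemma heap_add_br (H : Type) (br : H -> H -> H -> H) (heap_br : is_heap br)
    (e w x y z : H) :
  heap_add br e w (br x y z) =
  br (heap_add br e w x) (heap_add br e w y) (heap_add br e w z).
Proof.
have mid := heap_mid_cancel H br heap_br.
case: heap_br => _ brA brl brr.
(* Opening only the last sum puts its [w] next to [br w e y], where [mid] removes both copies of
   [w]. *)
by rewrite /heap_add (brA _ _ w e z) mid -!brA brl.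
Qed.

Theorem corollary3p37 (H : Type) (br : H -> H -> H -> H)
    (abelian_heap_br : is_abelian_heap br) (e : H) :
  is_commutative_braceable_truss br (heap_mul br e)
  /\ is_two_sided_brace (heap_add br e) (heap_mul br e).
Proof.
have heap_br := abelian_heap_heap abelian_heap_br.
have addG := heap_add_group H br heap_br e.
have addC := heap_addC H br abelian_heap_br e.
have add_br := heap_add_br H br heap_br e.
change (heap_mul br e) with (heap_add br e).
have [addA add0 addr0 _ addN] := addG.
have addK x y : heap_add br e (heap_add br e x y) (br e x e) = y.
  by rewrite (addC x) -addA addN addr0.
split.
  (* Left distributivity is [add_br]; the right one follows from it by commutativity. *)
  split; [split=> // w x y z | exact: addC | by exists e].
  by rewrite addC add_br !(addC w).
(* Both groups coincide, so zero and one are both [e], and [br e x e] is $-x$ in each. *)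
exists e, (fun x => br e x e), e, (fun x => br e x e); split=> // a b c.
- by rewrite addK !addA (addC a).
- by rewrite (addC b a) addK addA.
Qed.
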